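(* Let $A$ be an $m$-by-$n$ $(0,1,\ast)$-matrix. A linear subspace $L\subseteq\{0,1\}^n$ (over $GF_2$) is a solution for $A$ if and only if $L\subseteq\ker M=\{\mathbf{x}: M\mathbf{x}=\mathbf{0}\}$ for some completion $M$ of $A$.
   Context: A $(0,1,\ast)$-matrix is a matrix with entries in $\{0,1,\ast\}$; all arithmetic is over $GF_2$. A completion of $A$ is a $(0,1)$-matrix obtained from $A$ by replacing each $\ast$ by $0$ or $1$. For $A=(a_{ij})$, an operator $G=(g_1,\dots,g_m):\{0,1\}^n\to\{0,1\}^m$ is consistent with $A$ if each $g_i$ depends only on the variables $x_j$ with $a_{ij}=\ast$. A set $L\subseteq\{0,1\}^n$ is a solution for $A$ if there exist a completion $M$ of $A$ and an operator $G$ consistent with $A$ such that $M\mathbf{x}=G(\mathbf{x})$ for all $\mathbf{x}\in L$. *)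

(* Defs.v *)
From HB Require Import structures.
From mathcomp Require Import all_boot all_order all_algebra.

Set Implicit Arguments.
Unset Strict Implicit.
Unset Printing Implicit Defensive.

Import GRing.Theory.
Local Open Scope ring_scope.

(* An entry of a (0,1,* )-matrix is [Some 0], [Some 1] or [None], where [None]
   stands for *. *)
Definition star_matrix (m n : nat) := 'M[option 'F_2]_(m, n).

Definition completion m n (A : star_matrix m n) (M : 'M['F_2]_(m, n)) : Prop :=
  forall i j b, A i j = Some b -> M i j = b.

Definition consistent m n (A : star_matrix m n)
    (G : 'cV['F_2]_n -> 'cV['F_2]_m) : Prop :=
  forall (i : 'I_m) (x y : 'cV['F_2]_n),
    (forall j, A i j = None -> x j 0 = y j 0) -> G x i 0 = G y i 0.

Definition solution m n (A : star_matrix m n) (L : {set 'cV['F_2]_n}) : Prop :=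
  exists (M : 'M['F_2]_(m, n)) (G : 'cV['F_2]_n -> 'cV['F_2]_m),
    [/\ completion A M, consistent A G & forall x, x \in L -> M *m x = G x].

(* Not [kermx], which is the kernel of the action on row vectors. *)
Definition col_kernel m n (M : 'M['F_2]_(m, n)) : {set 'cV['F_2]_n} :=
  [set x | M *m x == 0].

(* Main.v *)
Require Import Defs.
From HB Require Import structures.
From mathcomp Require Import all_boot all_order all_algebra.

(** If [L] is a solution through [M] and [G], then row [i] of [M] is a linear
    functional on [L] whose value depends only on the starred coordinates of
    row [i], and it vanishes at [0].  It therefore vanishes at every point of
    [L] whose starred coordinates are [0], so on [L] it agrees with a linear
    functional of the starred coordinates alone.  Subtracting that functional
    changes only starred entries and gives a row that vanishes on [L]. *)

Set Implicit Arguments.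
Unset Strict Implicit.
Unset Printing Implicit Defensive.

Import GRing.Theory.
Local Open Scope ring_scope.

(** With the columns of [B] a basis of [L], the hypothesis says that [r *m B] kills the kernel of
    [D *m B], hence lies in the row space of [D *m B]. *)
Lemma functional_factors (F : fieldType) (n p : nat) (L : {vspace 'cV[F]_n})
    (r : 'rV[F]_n) (D : 'M[F]_(p, n)) :
  (forall x, x \in L -> D *m x = 0 -> r *m x = 0) ->
  exists c : 'rV[F]_p, forall x, x \in L -> r *m x = c *m D *m x.
Proof.
move=> rD0; pose B := \matrix_(i < n, j < \dim L) (vbasis L)`_j i 0.
have BE (y : 'cV_(\dim L)) : B *m y = \sum_j y j 0 *: (vbasis L)`_j.
  apply/colP=> i; rewrite mxE summxE; apply: eq_bigr => j _.
  by rewrite !mxE mulrC.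
have BL (y : 'cV_(\dim L)) : B *m y \in L.
  rewrite BE memv_suml // => j _; rewrite memvZ // vbasis_mem // mem_nth //.
  by rewrite size_tuple.
have /submxP[c rBE] : (r *m B <= D *m B)%MS.
  rewrite submxE; apply/eqP/row_matrixP => k; apply/rowP => j.
  set K := cokermx _.
  (* Each column of [K] is killed by [D *m B], so [B] sends it to a point of [L] where [D]
     vanishes. *)
  have -> : row k (r *m B *m K) 0 j = (r *m (B *m col j K)) k 0.
    by rewrite colE !mulmxA -colE !mxE.
  rewrite rD0 ?[RHS]mxE ?[LHS]mxE //.
  by rewrite colE 2!mulmxA mulmx_coker mul0mx.
exists c => x Lx.
have -> : x = B *m \col_j coord (vbasis L) j x.
  rewrite BE [LHS](coord_vbasis Lx); apply: eq_bigr => j _.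
  by rewrite mxE.
by rewrite mulmxA rBE !mulmxA.
Qed.

Theorem theorem4 (m n : nat) (A : star_matrix m n)
    (L : {vspace 'cV['F_2]_n}) :
  solution A [set x in L] <->
  exists M : 'M['F_2]_(m, n),
    completion A M /\ [set x in L] \subset col_kernel M.
Proof.
split=> [[M [G [AM AG MG]]] | [M [AM /subsetP LM]]]; last first.
  exists M, (fun=> 0); split=> // x /LM.
  by rewrite inE => /eqP.
(* Projection onto the starred coordinates of row [i]; any [c *m D i] is supported there. *)
pose D i : 'M['F_2]_n := diag_mx (\row_j (A i j == None)%:R).
have DE p (N : 'M_(p, n)) i k j : (N *m D i) k j = N k j * (A i j == None)%:R.
  by rewrite mul_mx_diag !mxE.
have /fin_all_exists[c cE] i : exists c : 'rV_n,
    forall x, x \in L -> row i M *m x = c *m D i *m x.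
  apply: functional_factors => x Lx Dx0.
  have Gx : G x i 0 = G 0 i 0.
    apply: AG => j Aij; have /colP/(_ j) := Dx0.
    by rewrite mul_diag_mx !mxE Aij eqxx mul1r.
  (* Since [0] lies in [L] too, [G 0 = M *m 0 = 0]. *)
  apply/rowP => k; rewrite ord1 -row_mul mxE MG ?inE // Gx.
  by rewrite -MG ?inE ?mem0v // mulmx0 !mxE.
exists (\matrix_i (row i M - c i *m D i)); split.
  move=> i j b Aij; rewrite mxE [LHS]mxE [X in _ + X]mxE DE Aij mulr0 subr0 mxE.
  exact: AM.
apply/subsetP => x; rewrite !inE => Lx; apply/eqP/row_matrixP => i.
by rewrite row_mul rowK mulmxBl cE // subrr row0.
Qed.
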